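(* There exist a compact operator $Z$ on a complex Hilbert space and fixed integers $j,k\ge0$ such that for every $p>2$, $$\mu^{\downarrow}_{1+j+k}\left(\left(\frac{|Z|^p+|Z^*|^p}{2}\right)^{1/p}\right)>\mu^{\downarrow}_{1+j}(\operatorname{Re}Z)+\mu^{\downarrow}_{1+k}(\operatorname{Im}Z).$$ Moreover, one may take $(j,k)=(2,0)$.
   Context: For a compact operator $T$, $\mu^{\downarrow}_j(T)$ is its $j$-th largest singular value (counted with multiplicity, $j=1,2,\dots$, with zeros appended if needed). $|Z|=(Z^*Z)^{1/2}$, $\operatorname{Re}Z=\frac{Z+Z^*}{2}$, $\operatorname{Im}Z=\frac{Z-Z^*}{2i}$. *)

(* Defs.v *)
From HB Require Import structures.
From mathcomp Require Import all_boot all_order all_algebra sesquilinear.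
From mathcomp Require Import all_classical all_reals all_analysis.
From mathcomp Require Import complex.

Set Implicit Arguments.
Unset Strict Implicit.
Unset Printing Implicit Defensive.

Import Order.TTheory GRing.Theory Num.Theory.
Import numFieldNormedType.Exports.

Local Open Scope classical_set_scope.
Local Open Scope complex_scope.
Local Open Scope ring_scope.

Record hilbertType (R : realType) := Hilbert {
  carrier :> completeNormedModType R[i] ;
  dotp : {dot carrier for Num.conj} ;
  dotp_norm : forall x : carrier, `|x| ^+ 2 = dotp x x
}.

Section Operators.
Variables (R : realType) (H : hilbertType R).
Implicit Types (T A B S : H -> H) (x y : H).

Definition bounded_operator T := linear T /\ continuous T.

Definition compact_operator T :=
  linear T /\ precompact (T @` [set x : H | `|x| <= 1]).

(* Equal to 0 (a junk value) if T has no bounded adjoint, which does not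
   happen for a bounded T. *)
Definition adjoint T : H -> H :=
  xget 0 [set S | bounded_operator S /\
    forall x y, dotp H (T x) y = dotp H x (S y)].

(* Functional calculus t |-> t ^ p, p > 0, on compact positive operators: A ^ p
   is the bounded operator acting as l ^ p on each eigenspace ker (A - l).  It
   is unique since the eigenspaces of such an A span a dense subspace. *)
Definition powop A (p : R) : H -> H :=
  xget 0 [set B | bounded_operator B /\
    forall (l : R) x, 0 <= l -> A x = l%:C *: x -> B x = (l `^ p)%:C *: x].

Definition absop T : H -> H := powop (adjoint T \o T) 2^-1.

Definition reop T : H -> H := fun x => 2^-1 *: (T x + adjoint T x).

Definition imop T : H -> H := fun x => (2 * 'i)^-1 *: (T x - adjoint T x).

(* The n-th largest (n >= 1) singular value of a compact operator T, counted
   with multiplicity: the largest t such that |T| has n orthonormal eigenvectors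
   with eigenvalues >= t, i.e., n eigenvalues >= t counted with multiplicity.
   The disjunct t = 0 accounts for the zeros appended when |T| has fewer than n
   eigenvalues. *)
Definition mu T (n : nat) : R :=
  sup [set t : R | t = 0 \/
    exists (l : 'I_n -> R) (e : 'I_n -> H),
      (forall i j, dotp H (e i) (e j) = (i == j)%:R) /\
      (forall i, absop T (e i) = (l i)%:C *: e i /\ t <= l i)].

Definition pmeanop T (p : R) : H -> H :=
  powop (fun x => 2^-1 *: (powop (absop T) p x + powop (absop (adjoint T)) p x))
    p^-1.

End Operators.

(* Main.v *)
From HB Require Import structures.
Require Import Defs.
From mathcomp Require Import all_boot all_order all_algebra sesquilinear spectral.
From mathcomp Require Import all_classical all_reals all_analysis.
From mathcomp Require Import complex ring lra.

(* Take

     Z = A + iB = [[7/12, i, 0], [i, 0, 0], [0, 0, 4/3]],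

   so that A = diag(7/12, 0, 4/3) has rank 2, and B swaps the first two basis
   vectors and kills the third: mu_3(A) = 0 and mu_1(B) = 1.  At p = 2 the power
   mean is (A^2 + B^2)^(1/2), whose third singular value is
   1 = mu_3(A) + mu_1(B).  It increases strictly with p, because ker A is not
   spanned by an eigenvector of Z^*Z.  Explicitly, |Z| and |Z^*| have
   eigenvalues 4/3, 3/4, 4/3, their eigenbases are complex conjugate to each
   other, and with x = (4/3)^p the mean of the p-th powers is the diagonal
   matrix with entries (16 x + 9/x)/25, (9 x + 16/x)/25 and x.  Since
   (9 x + 16/x)/25 - 1 = (9 x - 16)(x - 1)/(25 x), all of them exceed 1 as soon
   as x > (4/3)^2. *)

Set Implicit Arguments.
Unset Strict Implicit.
Unset Printing Implicit Defensive.

Import Order.TTheory GRing.Theory Num.Theory.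
Import numFieldNormedType.Exports.

Local Open Scope classical_set_scope.
Local Open Scope complex_scope.
Local Open Scope sesquilinear_scope.
Local Open Scope ring_scope.

(** * Finite-dimensional complex Hilbert spaces *)

Lemma norm_Re_Im_le (R : rcfType) (z : R[i]) (r : R) :
  `|z| <= r%:C -> `|complex.Re z| <= r /\ `|complex.Im z| <= r.
Proof.
rewrite normc_def lecR => zr; split; apply: le_trans zr.
  by rewrite -sqrtr_sqr ler_wsqrtr// lerDl sqr_ge0.
by rewrite -sqrtr_sqr ler_wsqrtr// lerDr sqr_ge0.
Qed.

(* A copy of ['rV[R[i]]_n], on which the library would put the sup norm. *)
Definition euclid (R : realType) (n : nat) := 'rV[R[i]]_n.

HB.instance Definition _ (R : realType) n := GRing.Lmodule.on (euclid R n).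

Section Euclid.
Variables (R : realType) (n : nat).
Local Notation E := (euclid R n).
Implicit Types x y : E.

Definition euclid_norm x : R[i] := sqrtC (dotmx x x).

Lemma euclid_normD x y : euclid_norm (x + y) <= euclid_norm x + euclid_norm y.
Proof. exact: (triangle_lerif (@dotmx R[i] n) x y).1. Qed.

Lemma euclid_normZ (c : R[i]) x : euclid_norm (c *: x) = `|c| * euclid_norm x.
Proof.
by rewrite /euclid_norm dnormZ sqrtCM ?qualifE/= ?exprn_ge0 ?dnorm_ge0// sqrCK.
Qed.

Lemma euclid_norm_eq0 x : euclid_norm x = 0 -> x = 0.
Proof. by move=> /eqP; rewrite sqrtC_eq0 dnorm_eq0 => /eqP. Qed.

HB.instance Definition _ := Lmodule_isNormed.Build R[i] E
  euclid_normD euclid_normZ euclid_norm_eq0.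

Lemma euclid_dot_norm x : `|x| ^+ 2 = dotmx x x.
Proof. exact: sqrtCK. Qed.

Lemma ler_coord_norm x i : `|x 0 i| <= `|x|.
Proof.
rewrite -(@ler_pXn2r _ 2) ?qualifE//= euclid_dot_norm dotmxE mxE (bigD1 i)//=.
by rewrite !mxE -normCK lerDl sumr_ge0// => j _; rewrite !mxE -normCK exprn_ge0.
Qed.

Lemma ler_norm_sum_coord x : `|x| <= \sum_i `|x 0 i|.
Proof.
rewrite {1}[x]row_sum_delta (le_trans (ler_norm_sum _ _ _))// ler_sum// => i _.
rewrite normrZ ler_piMr// -(@ler_pXn2r _ 2) ?qualifE//= euclid_dot_norm.
rewrite dotmxE mxE (bigD1 i)//= big1 => [|j /negPf ji]; rewrite !mxE ?eqxx ?ji/=.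
  by rewrite conjC1 mulr1 addr0 expr1n.
by rewrite mul0r.
Qed.

(** Identifies R^(2n) with C^n, real parts first, so that compactness of real boxes can be carried
    over to the complex space. *)
Definition of_rect (v : 'rV[R]_(n + n)) : E :=
  \row_i (v 0 (lshift n i) +i* v 0 (rshift n i)).

Lemma of_rect_continuous : continuous of_rect.
Proof.
move=> v; apply/(@cvgrPdist_lt _ _ _ (nbhs v) (nbhs_filter v)) => e e0.
(* Norms take values in [R[i]], so the positive radius [e] must first be recognized as real. *)
have [r er] : exists r : R, e = r%:C.
  by exists (complex.Re e); rewrite RRe_real// gtr0_real.
move: e0; rewrite {}er (ltcR 0) => r0.
(* Each of the n coordinates moves by less than 2d, and 2dn = rn/(n+1) < r; the successor keeps this
   strict and covers n = 0. *)
pose d := r / (2 * n.+1%:R).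
have d0 : 0 < d by rewrite divr_gt0// mulr_gt0.
have := nbhsx_ballx v d d0; apply: filterS => w vw.
apply: le_lt_trans (ler_norm_sum_coord _) _.
apply: (@le_lt_trans _ _ (\sum_(i < n) (2 * d)%:C)).
  apply: ler_sum => i _; rewrite !mxE.
  have [_ dvw] := vw; have d1 := dvw 0 (lshift n i); have d2 := dvw 0 (rshift n i).
  rewrite [X in `|X|]complexE/= (le_trans (ler_normD _ _))// normrM.
  rewrite !normc_def/= !(expr0n, expr1n, addr0, add0r, sqrtr1, mul1r) !sqrtr_sqr.
  by rewrite -rmorphD lecR mulr_natl mulr2n lerD// ltW.
rewrite sumr_const card_ord -rmorphMn ltcR -mulr_natr /d.
rewrite mulrA -mulf_div divff// mul1r mulrAC ltr_pdivrMr// ltr_pM2l// ltr_nat//.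
Qed.

(** The image of the box [-c, c]^(2n) is compact and contains the ball, because the norm dominates
    each real and imaginary part. *)
Lemma coord_bounded_compact (c : R) : exists2 K : set E, compact K &
  [set x : E | `|x| <= c%:C] `<=` K.
Proof.
exists (of_rect @` [set v : 'rV[R]_(n + n) |
    forall i, `[- c, c]%classic (v ord0 i)]).
  apply: continuous_compact; last first.
    apply: (@rV_compact R (n + n) (fun=> `[- c, c]%classic)) => i.
    exact: segment_compact.
  by apply: continuous_subspaceT; exact: of_rect_continuous.
move=> x/= xc; exists (row_mx (\row_i complex.Re (x 0 i)) (\row_i complex.Im (x 0 i))).
  move=> i; rewrite /= in_itv/= -ler_norml mxE; case: splitP => {}i _; rewrite mxE.
    by apply: (norm_Re_Im_le _).1; exact: le_trans (ler_coord_norm x i) xc.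
  by apply: (norm_Re_Im_le _).2; exact: le_trans (ler_coord_norm x i) xc.
by apply/rowP => i; rewrite mxE row_mxEl row_mxEr !mxE; case: (x 0 i).
Qed.

(** A Cauchy filter contains a ball of radius 1, which lies in a compact set, and there it
    converges. *)
Lemma euclid_cauchy_cvg (F : set_system E) : ProperFilter F -> cauchy F -> cvg F.
Proof.
move=> PF cF; have /cauchyP/(_ 1 ltr01)[x Fx] := cF.
have [r xr] : exists r : R, `|x| + 1 = r%:C.
  by exists (complex.Re (`|x| + 1)); rewrite RRe_real// ger0_real// addr_ge0.
have [K cK rK] := coord_bounded_compact r.
apply: (compact_cauchy_cvg PF cF _ cK); apply: filterS Fx => y xy; apply: rK => /=.
by rewrite -xr -[y](subrK x) (le_trans (ler_normD _ _))// addrC lerD2l distrC ltW.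
Qed.

HB.instance Definition _ := Uniform_isComplete.Build E euclid_cauchy_cvg.

Definition euclid_hilbert : hilbertType R := @Hilbert R E (@dotmx R[i] n) euclid_dot_norm.

End Euclid.

(** * Matrix operators, their adjoints and functional calculus *)

Section MatrixOperators.
Variables (R : realType) (n : nat).
Local Notation H := (euclid_hilbert R n).
Implicit Types (M N U : 'M[R[i]]_n) (s : 'I_n -> R) (x y : H).

(** Multiplication on the right reverses composition: T^*T is given by [M *m M ^t*]. *)
Definition mxop M : H -> H := fun x => (x : 'rV_n) *m M.

Lemma mxop_linear M : linear (mxop M).
Proof. by move=> c x y; rewrite /mxop mulmxDl scalemxAl. Qed.

Lemma linear_mxop (T : H -> H) : linear T -> exists M, T = mxop M.
Proof.
move=> lT; pose f : {linear 'rV[R[i]]_n -> 'rV[R[i]]_n} :=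
  HB.pack (T : 'rV[R[i]]_n -> 'rV[R[i]]_n) (GRing.isLinear.Build _ _ _ _ _ lT).
exists (lin1_mx f); apply/funext => x.
by rewrite /mxop mul_rV_lin1.
Qed.

Lemma mxop_norm M x : `|mxop M x| <= `|x| * \sum_j \sum_i `|M i j|.
Proof.
apply: le_trans (ler_norm_sum_coord _) _; rewrite mulr_sumr ler_sum// => j _.
rewrite mxE mulr_sumr (le_trans (ler_norm_sum _ _ _))// ler_sum// => i _.
by rewrite normrM ler_wpM2r// ler_coord_norm.
Qed.

Lemma mxop_bounded M : bounded_operator (mxop M).
Proof.
split; first exact: mxop_linear.
pose f : {linear H -> H} :=
  HB.pack (mxop M) (GRing.isLinear.Build _ _ _ _ _ (@mxop_linear M)).
apply: (@bounded_linear_continuous _ _ _ f); apply/bounded_funP => r.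
exists (r * \sum_j \sum_i `|M i j|) => x xr.
apply: le_trans (mxop_norm M x) _; rewrite ler_wpM2r//.
by rewrite sumr_ge0// => j _; rewrite sumr_ge0.
Qed.

Lemma mxop_compact M : compact_operator (mxop M).
Proof.
split; first exact: mxop_linear.
pose b := \sum_j \sum_i `|M i j|.
have b0 : 0 <= b by rewrite sumr_ge0// => j _; rewrite sumr_ge0.
have [K cK bK] := coord_bounded_compact n (complex.Re b).
exists K; last by split=> //; apply: compact_closed => //; exact: norm_hausdorff.
move=> _ [x/= x1 <-]; apply: bK => /=; rewrite RRe_real ?ger0_real//.
by apply: le_trans (mxop_norm M x) _; rewrite ler_piMl.
Qed.

Lemma dot_mxop M x y : dotp H (mxop M x) y = dotp H x (mxop (M ^t*) y).
Proof.
rewrite /= !dotmxE /mxop.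
by rewrite trmx_mul map_mxM/= trmxCK mulmxA.
Qed.

(** Adjoints are unique: the difference d of two candidates at y satisfies <d, d> = <Md, y> - <Md,
    y> = 0. Hence [xget] can only return this one. *)
Lemma adjoint_mxop M : adjoint (mxop M) = mxop (M ^t*).
Proof.
have P : bounded_operator (mxop (M ^t*)) /\
    forall x y, dotp H (mxop M x) y = dotp H x (mxop (M ^t*) y).
  by split; [exact: mxop_bounded|exact: dot_mxop].
apply: xget_unique => // S [_ dS]; apply/funext => y; apply/eqP.
rewrite -subr_eq0 -[_ == 0](dnorm_eq0 (dotp H)) linearBr/=.
by rewrite -dS -dot_mxop subrr.
Qed.

Lemma mxop_comp M N : mxop M \o mxop N = mxop (N *m M).
Proof. by apply/funext => x; rewrite /mxop/= mulmxA. Qed.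

Lemma mxopD M N x : mxop M x + mxop N x = mxop (M + N) x.
Proof. by rewrite /mxop mulmxDr. Qed.

Lemma mxopB M N x : mxop M x - mxop N x = mxop (M - N) x.
Proof. by rewrite /mxop mulmxBr. Qed.

Lemma mxopZ c M x : c *: mxop M x = mxop (c *: M) x.
Proof. by rewrite /mxop scalemxAr. Qed.

(* The rows of U are eigenvectors: the matrices act on row vectors. *)
Definition spectral_mx U s : 'M[R[i]]_n :=
  U ^t* *m diag_mx (\row_i (s i)%:C) *m U.

Lemma unitary_adjK U : U \is unitarymx -> U ^t* *m U = 1%:M.
Proof. by move=> /unitarymxP/mulmx1C. Qed.

(** The row x U^* holds the coordinates of x in the orthonormal basis of rows of U, where the
    operator is diagonal. *)
Lemma spectral_eigenP U s (l : R) x : U \is unitarymx ->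
  mxop (spectral_mx U s) x = l%:C *: x <->
  forall i, ((x : 'rV_n) *m U ^t*) 0 i * (s i)%:C =
            l%:C * ((x : 'rV_n) *m U ^t*) 0 i.
Proof.
move=> uU; rewrite /mxop /spectral_mx !mulmxA; split => [xl i|xl].
  have := congr1 (fun v : 'rV_n => v *m U ^t*) xl.
  rewrite -[LHS]mulmxA (unitarymxP uU) mulmx1 -scalemxAl => /rowP/(_ i).
  by rewrite mul_mx_diag !mxE.
rewrite -[RHS]mulmx1 -(unitary_adjK uU) mulmxA; congr (_ *m U).
by apply/rowP => i; rewrite mul_mx_diag -scalemxAl !mxE; have := xl i; rewrite !mxE.
Qed.

Lemma spectral_row U s i : U \is unitarymx ->
  mxop (spectral_mx U s) (row i U) = (s i)%:C *: (row i U : H).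
Proof.
move=> uU; apply/(spectral_eigenP _ _ _ uU) => j.
rewrite -row_mul (unitarymxP uU) !mxE.
by case: eqP => [->|]; rewrite ?mulr0 ?mul0r// mul1r mulr1.
Qed.

Lemma powop_spectral U s p : U \is unitarymx -> (forall i, 0 <= s i) ->
  powop (mxop (spectral_mx U s)) p = mxop (spectral_mx U (fun i => s i `^ p)).
Proof.
move=> uU s0; have P : bounded_operator (mxop (spectral_mx U (fun i => s i `^ p))) /\
    forall (l : R) x, 0 <= l -> mxop (spectral_mx U s) x = l%:C *: x ->
      mxop (spectral_mx U (fun i => s i `^ p)) x = (l `^ p)%:C *: x.
  split=> [|l x l0 /(spectral_eigenP _ _ _ uU) xl]; first exact: mxop_bounded.
  apply/(spectral_eigenP _ _ _ uU) => i; have /eqP := xl i.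
  (* For each i, either [s i] = l or the i-th coordinate of x vanishes; both cases give the
     claim. *)
  rewrite mulrC -subr_eq0 -mulrBl mulf_eq0.
  case/orP => [|/eqP->]; rewrite ?mul0r ?mulr0// subr_eq0 => /eqP/complexI->.
  by rewrite mulrC.
(* Uniqueness: any candidate is a matrix whose values on the rows of U, a basis, are prescribed. *)
apply: xget_unique => // B [[lB _] BP]; have [N {lB}BN] := linear_mxop lB.
rewrite {}BN in BP *; congr mxop; suff: U *m N = U *m spectral_mx U (fun i => s i `^ p).
  by move=> /(congr1 (mulmx (U ^t*))); rewrite !mulmxA (unitary_adjK uU) !mul1mx.
apply/row_matrixP => i; rewrite !row_mul.
have e := spectral_row s i uU.
by have := BP _ _ (s0 i) e; have := P.2 _ _ (s0 i) e; rewrite /mxop => -> ->.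
Qed.

Lemma absop_mxop M U s : U \is unitarymx -> (forall i, 0 <= s i) ->
  M *m M ^t* = spectral_mx U (fun i => s i ^+ 2) ->
  absop (mxop M) = mxop (spectral_mx U s).
Proof.
move=> uU s0 MM; rewrite /absop adjoint_mxop mxop_comp MM powop_spectral//; last first.
  by move=> i; rewrite exprn_ge0.
congr (mxop (spectral_mx U _)); apply/funext => i.
by rewrite powR12_sqrt ?exprn_ge0// sqrtr_sqr ger0_norm.
Qed.

(** With the eigenvectors as rows of a unitary V, one has V M = D V with D diagonal, and the nonzero
    det V cancels. *)
Lemma det_orthonormal_eigen M (l : 'I_n -> R) (e : 'I_n -> H) :
  (forall i j, dotp H (e i) (e j) = (i == j)%:R) ->
  (forall i, mxop M (e i) = (l i)%:C *: e i) -> \det M = \prod_i (l i)%:C.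
Proof.
move=> oe el; pose V : 'M[R[i]]_n := \matrix_i e i.
have uV : V \is unitarymx.
  by apply/row_unitarymxP => i j; rewrite !rowK; exact: oe.
have VM : V *m M = diag_mx (\row_i (l i)%:C) *m V.
  apply/matrixP => i j; have /rowP/(_ j) := el i.
  rewrite /mxop mul_diag_mx !mxE => <-; by apply: eq_bigr => k _; rewrite mxE.
have /(congr1 determinant) := VM; rewrite !det_mulmx det_diag mulrC => /mulIf -> //.
  by apply: eq_bigr => i _; rewrite mxE.
by rewrite -unitfE -[_ \is a _]unitmxE unitarymx_unit.
Qed.

Lemma spectral_eigenvalue U s (l : R) x : U \is unitarymx -> x != 0 ->
  mxop (spectral_mx U s) x = l%:C *: x -> exists i, l = s i.
Proof.
move=> uU /eqP x0 /(spectral_eigenP _ _ _ uU) xl; apply: contrapT => nl; apply: x0.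
suff x0 : (x : 'rV_n) *m U ^t* = 0.
  by rewrite -[LHS]mulmx1 -(unitary_adjK uU) mulmxA x0 mul0mx.
apply/rowP => i; rewrite [RHS]mxE; have /eqP := xl i.
rewrite mulrC -subr_eq0 -mulrBl mulf_eq0 => /orP[|/eqP//].
by rewrite subr_eq0 => /eqP/complexI li; case: nl; exists i.
Qed.

(** * Bounds on singular values *)

Definition mu_set (T : H -> H) k : set R := [set t : R | t = 0 \/
  exists (l : 'I_k -> R) (e : 'I_k -> H),
    (forall i j, dotp H (e i) (e j) = (i == j)%:R) /\
    (forall i, absop T (e i) = (l i)%:C *: e i /\ t <= l i)].

(** The first of the k eigenvectors is nonzero, so its eigenvalue, which is at least t, is some
    [s i]. The appended zero is covered by 0 <= c. *)
Lemma mu_set_ubound T U s k c : U \is unitarymx ->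
  absop T = mxop (spectral_mx U s) -> (0 < k)%N -> 0 <= c ->
  (forall i, s i <= c) -> ubound (mu_set T k) c.
Proof.
move=> uU Ts k0 c0 sc t [->//|[l [e [oe]]]] /(_ (Ordinal k0))[].
rewrite Ts => /(spectral_eigenvalue uU)[|i -> /le_trans]; last exact.
apply/eqP => e0; have /eqP := oe (Ordinal k0) (Ordinal k0).
by rewrite e0 linear0r eqxx eq_sym oner_eq0.
Qed.

Lemma mu_le T U s k c : U \is unitarymx ->
  absop T = mxop (spectral_mx U s) -> (0 < k)%N -> 0 <= c ->
  (forall i, s i <= c) -> mu T k <= c.
Proof.
move=> uU Ts k0 c0 sc; apply: (@ge_sup _ (mu_set T k)); first by exists 0; left.
exact: mu_set_ubound Ts k0 c0 sc.
Qed.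

Lemma mu_dim_ge T U s t : U \is unitarymx ->
  absop T = mxop (spectral_mx U s) -> (0 < n)%N ->
  (forall i, 0 <= s i) -> (forall i, t <= s i) -> t <= mu T n.
Proof.
move=> uU Ts n0 s0 ts; apply: (@ub_le_sup _ (mu_set T n)).
  (* The supremum is meaningful only for a set bounded above; the sum dominates each nonnegative
     [s i]. *)
  exists (\sum_i s i); apply: mu_set_ubound Ts n0 _ _ => //; first exact: sumr_ge0.
  by move=> i; rewrite (bigD1 i)//= lerDl sumr_ge0.
right; exists s, (fun i => row i U); split=> [i j|i].
  exact: (row_unitarymxP uU).
by rewrite Ts spectral_row.
Qed.

(** A positive t in the set would give a full orthonormal basis of eigenvectors with positive
    eigenvalues, whose product is the determinant 0. *)
Lemma mu_dim_singular T M : absop T = mxop M -> \det M = 0 -> mu T n <= 0.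
Proof.
move=> TM M0; apply: (@ge_sup _ (mu_set T n)); first by exists 0; left.
move=> t [->//|[l [e [oe el]]]]; rewrite leNgt; apply/negP => t0.
have /eqP := M0; rewrite (@det_orthonormal_eigen M l e) // => [|i]; last first.
  by rewrite -TM (el i).1.
apply/negP/prodf_neq0 => i _.
by rewrite (inj_eq (@complexI _) _ 0) gt_eqF// (lt_le_trans t0 (el i).2).
Qed.

End MatrixOperators.

(** * Calculus of 3 by 3 matrices with blocks of sizes 2 and 1 *)

Section Block.
Variable R : realType.
Local Notation C := R[i].

(** This shape is stable under sums, products, scaling and adjoints, so every matrix computation
    below reduces to five entries. *)
Definition block21 (a b c d k : C) : 'M[C]_3 := \matrix_(i, j)
  nth 0 (nth [::] [:: [:: a; b; 0]; [:: c; d; 0]; [:: 0; 0; k]] i) j.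

Definition triple (a b c : R) (i : 'I_3) : R := nth 0 [:: a; b; c] i.

Ltac entries3 := apply/matrixP => -[[|[|[|//]]] ?] [[|[|[|//]]] ?].

Ltac complex_split := apply/eqP; rewrite eq_complex /=; apply/andP; split; apply/eqP.
Ltac complex_ring := complex_split; ring.
Ltac complex_field := complex_split; by field.

Lemma block21_mul a b c d k a' b' c' d' k' :
  block21 a b c d k *m block21 a' b' c' d' k' =
  block21 (a * a' + b * c') (a * b' + b * d')
          (c * a' + d * c') (c * b' + d * d') (k * k').
Proof.
by entries3; rewrite !mxE !big_ord_recl big_ord0 !mxE/= ?(mul0r, mulr0, addr0, add0r).
Qed.

Lemma block21D a b c d k a' b' c' d' k' :
  block21 a b c d k + block21 a' b' c' d' k' =
  block21 (a + a') (b + b') (c + c') (d + d') (k + k').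
Proof. by entries3; rewrite !mxE/= ?addr0. Qed.

Lemma block21B a b c d k a' b' c' d' k' :
  block21 a b c d k - block21 a' b' c' d' k' =
  block21 (a - a') (b - b') (c - c') (d - d') (k - k').
Proof. by entries3; rewrite !mxE/= ?subrr. Qed.

Lemma block21Z e a b c d k :
  e *: block21 a b c d k = block21 (e * a) (e * b) (e * c) (e * d) (e * k).
Proof. by entries3; rewrite !mxE/= ?mulr0. Qed.

Lemma block21_adj a b c d k :
  (block21 a b c d k) ^t* = block21 (a^*)%C (c^*)%C (b^*)%C (d^*)%C (k^*)%C.
Proof. by entries3; rewrite !mxE/= ?conjC0. Qed.

Lemma block21_1 : block21 1 0 0 1 1 = 1%:M.
Proof. by entries3; rewrite !mxE. Qed.

Lemma diag_triple a b c :
  diag_mx (\row_i (triple a b c i)%:C) = block21 a%:C 0 0 b%:C c%:C.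
Proof. by entries3; rewrite !mxE. Qed.

Lemma triple_map (f : R -> R) a b c :
  (fun i => f (triple a b c i)) = triple (f a) (f b) (f c).
Proof. by apply/funext => -[[|[|[|//]]] ?]. Qed.

Lemma triple_ge t a b c : t <= a -> t <= b -> t <= c ->
  forall i, t <= triple a b c i.
Proof. by move=> ? ? ? [[|[|[|//]]] ?]. Qed.

Lemma triple_le t a b c : a <= t -> b <= t -> c <= t ->
  forall i, triple a b c i <= t.
Proof. by move=> ? ? ? [[|[|[|//]]] ?]. Qed.

Lemma unitarymx1 : (1%:M : 'M[C]_3) \is unitarymx.
Proof. by apply/unitarymxP; rewrite trmx1 map_mx1 mulmx1. Qed.

Lemma spectral_mx1 a b c :
  spectral_mx 1%:M (triple a b c) = block21 a%:C 0 0 b%:C c%:C :> 'M[C]_3.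
Proof. by rewrite /spectral_mx trmx1 map_mx1 mul1mx mulmx1 diag_triple. Qed.

Lemma absop_block21 a b c : 0 <= a -> 0 <= b -> 0 <= c ->
  absop (mxop (block21 a%:C 0 0 b%:C c%:C)) = mxop (spectral_mx 1%:M (triple a b c)).
Proof.
move=> a0 b0 c0; apply: absop_mxop; [exact: unitarymx1| |].
  exact: triple_ge.
rewrite (triple_map (fun t => t ^+ 2)) spectral_mx1 block21_adj block21_mul.
congr block21; complex_ring.
Qed.

Lemma powop_block21 a b c p : 0 <= a -> 0 <= b -> 0 <= c ->
  powop (mxop (block21 a%:C 0 0 b%:C c%:C)) p =
  mxop (block21 (a `^ p)%:C 0 0 (b `^ p)%:C (c `^ p)%:C).
Proof.
move=> a0 b0 c0; rewrite -!spectral_mx1 powop_spectral.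
    by rewrite (triple_map (fun t => t `^ p)).
  exact: unitarymx1.
exact: triple_ge.
Qed.

(** * The operator Z and its two absolute values *)

Definition Zmx : 'M[C]_3 := block21 (7 / 12)%:C (0 +i* 1) (0 +i* 1) 0 (4 / 3)%:C.

(* [r = 1] diagonalizes [Zmx *m Zmx ^t*] and [r = -1] diagonalizes
   [Zmx ^t* *m Zmx]. *)
Definition Umx (r : R) : 'M[C]_3 :=
  block21 (4 / 5)%:C (0 +i* (- (3 / 5) * r)) (0 +i* (- (3 / 5) * r)) (4 / 5)%:C 1.

Lemma Umx_unitary r : r ^+ 2 = 1 -> Umx r \is unitarymx.
Proof.
move=> /eqP; rewrite sqrf_eq1 => r1.
apply/unitarymxP; rewrite /Umx block21_adj block21_mul -block21_1.
case/orP: r1 => /eqP->; congr block21; complex_field.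
Qed.

(** The off-diagonal entries are odd in r and the diagonal ones do not depend on r, so averaging r =
    1 and r = -1 leaves a diagonal matrix. *)
Lemma spectral_Umx r a b : r ^+ 2 = 1 ->
  spectral_mx (Umx r) (triple a b a) =
  block21 ((16 * a + 9 * b) / 25)%:C (0 +i* (12 / 25 * r * (b - a)))
          (0 +i* (12 / 25 * r * (a - b))) ((9 * a + 16 * b) / 25)%:C a%:C.
Proof.
move=> /eqP; rewrite sqrf_eq1 /spectral_mx diag_triple /Umx block21_adj !block21_mul.
case/orP => /eqP->; congr block21; complex_field.
Qed.

Lemma half_complex : 2^-1 = (2^-1)%:C :> C.
Proof. by rewrite fmorphV rmorph_nat. Qed.

Lemma half_i_complex : (2 * 'i)^-1 = (0 +i* - 2^-1) :> C.
Proof.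
rewrite invfM invCi half_complex -complexiE; complex_ring.
Qed.

Definition Zop : euclid_hilbert R 3 -> euclid_hilbert R 3 := mxop Zmx.

(** Since 7/12 = 4/3 - 3/4, the upper block of Z Z^* has determinant 1 and trace 337/144 = (4/3)^2 +
    (3/4)^2, whence the singular values 4/3 and 3/4. *)
Lemma absop_Zop : absop Zop = mxop (spectral_mx (Umx 1) (triple (4 / 3) (3 / 4) (4 / 3))).
Proof.
apply: absop_mxop; first by apply: Umx_unitary; rewrite expr1n.
  by apply: triple_ge; lra.
rewrite (triple_map (fun t => t ^+ 2)) spectral_Umx ?expr1n//.
rewrite /Zmx block21_adj block21_mul.
congr block21; complex_field.
Qed.

Lemma absop_adj_Zop :
  absop (adjoint Zop) = mxop (spectral_mx (Umx (- 1)) (triple (4 / 3) (3 / 4) (4 / 3))).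
Proof.
rewrite adjoint_mxop; apply: absop_mxop.
    by apply: Umx_unitary; rewrite sqrrN expr1n.
  by apply: triple_ge; lra.
rewrite trmxCK (triple_map (fun t => t ^+ 2)) spectral_Umx ?sqrrN ?expr1n//.
rewrite /Zmx block21_adj block21_mul.
congr block21; complex_field.
Qed.

(** * Singular values of the power mean, Re Z and Im Z *)

Definition mean1 (x : R) := (16 * x + 9 / x) / 25.
Definition mean2 (x : R) := (9 * x + 16 / x) / 25.

Lemma mean_gt1 x : 16 / 9 < x -> 1 < mean1 x /\ 1 < mean2 x.
Proof.
move=> x1; have x0 : 0 < x by lra.
rewrite -[1 < mean1 x]subr_gt0 -[1 < mean2 x]subr_gt0.
have -> : mean1 x - 1 = (16 * x - 9) * (x - 1) / (25 * x).
  by rewrite /mean1; field; rewrite gt_eqF.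
have -> : mean2 x - 1 = (9 * x - 16) * (x - 1) / (25 * x).
  by rewrite /mean2; field; rewrite gt_eqF.
by split; rewrite divr_gt0// mulr_gt0//; lra.
Qed.

Lemma pow43_gt (p : R) : 2 < p -> 16 / 9 < (4 / 3) `^ p.
Proof.
move=> p2; have -> : (16 / 9 : R) = (4 / 3) `^ 2 by rewrite powR_mulrn; [field|lra].
rewrite /powR gt_eqF; last lra.
by rewrite ltr_expR ltr_pM2r// ln_gt0//; lra.
Qed.

Lemma mu_pmean_Zop (p : R) : 2 < p -> 1 < mu (pmeanop Zop p) 3.
Proof.
move=> p2; pose x : R := (4 / 3) `^ p.
have x_gt : 16 / 9 < x := pow43_gt p2.
have [m1 m2] := mean_gt1 x_gt; have x1 : 1 < x by lra.
have p1 : 0 < p^-1 by rewrite invr_gt0; lra.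
have pow_gt1 (t : R) : 1 < t -> 1 < t `^ p^-1.
  move=> t1; have := gt0_ltr_powR p1 _ _ t1; rewrite powR1; apply.
    by rewrite qualifE/=.
  by rewrite qualifE/=; lra.
have E : pmeanop Zop p =
    mxop (block21 (mean1 x `^ p^-1)%:C 0 0 (mean2 x `^ p^-1)%:C (x `^ p^-1)%:C).
  have powopU r : r ^+ 2 = 1 ->
      powop (mxop (spectral_mx (Umx r) (triple (4 / 3) (3 / 4) (4 / 3)))) p =
      mxop (spectral_mx (Umx r) (triple x ((3 / 4) `^ p) x)).
    move=> r1; rewrite (powop_spectral _ (Umx_unitary r1)).
      by rewrite (triple_map (fun t => t `^ p)).
    by apply: triple_ge; lra.
  rewrite /pmeanop absop_Zop absop_adj_Zop !powopU ?sqrrN ?expr1n//.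
  rewrite !spectral_Umx ?sqrrN ?expr1n//.
  (* The eigenvalues 4/3 and 3/4 are reciprocal, so the single parameter x describes both powers. *)
  have -> : (3 / 4) `^ p = x^-1 :> R.
    have -> : 3 / 4 = (4 / 3) `^ (- 1) :> R by rewrite powR_inv1; [field|lra].
    by rewrite powRAC powR_inv1 ?powR_ge0.
  rewrite -powop_block21; [|lra|lra|lra]; congr powop; apply/funext => v.
  rewrite half_complex mxopD mxopZ block21D block21Z.
  by congr (mxop (block21 _ _ _ _ _) v); rewrite /mean1 /mean2; complex_split;
    field; rewrite ?gt_eqF//; lra.
have q1 := pow_gt1 _ m1; have q2 := pow_gt1 _ m2; have q3 := pow_gt1 _ x1.
(* The smallest of the three eigenvalues bounds the third singular value from below; it exceeds 1
   strictly. *)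
pose t := Num.min (mean1 x `^ p^-1) (Num.min (mean2 x `^ p^-1) (x `^ p^-1)).
apply: (@lt_le_trans _ _ t).
  by rewrite !lt_min q1 q2.
apply: mu_dim_ge; first exact: unitarymx1.
- by rewrite E absop_block21// ?powR_ge0.
- by [].
- by apply: triple_ge; rewrite powR_ge0.
- by apply: triple_ge; rewrite !ge_min lexx ?orbT.
Qed.

Lemma mu_re_Zop : mu (reop Zop) 3 <= 0.
Proof.
have E : reop Zop = mxop (block21 (7 / 12)%:C 0 0 0%:C (4 / 3)%:C).
  apply/funext => v; rewrite /reop half_complex adjoint_mxop mxopD mxopZ.
  rewrite /Zmx block21_adj block21D block21Z.
  by congr (mxop (block21 _ _ _ _ _) v); complex_field.
apply: (@mu_dim_singular _ _ _ (spectral_mx 1%:M (triple (7 / 12) 0 (4 / 3)))).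
  by rewrite E absop_block21//; lra.
(* The middle diagonal entry, of index 1, makes the determinant vanish. *)
rewrite spectral_mx1 -diag_triple det_diag; apply/eqP/prodf_eq0; exists (inord 1) => //.
by rewrite mxE /triple inordK.
Qed.

Lemma mu_im_Zop : mu (imop Zop) 1 <= 1.
Proof.
have E : imop Zop = mxop (block21 0 1 1 0 0).
  apply/funext => v; rewrite /imop half_i_complex adjoint_mxop mxopB mxopZ.
  rewrite /Zmx block21_adj block21B block21Z.
  by congr (mxop (block21 _ _ _ _ _) v); complex_field.
(* The swap squares to diag(1, 1, 0), which is therefore also its absolute value. *)
apply: (@mu_le _ _ _ 1%:M (triple 1 1 0)) => //; first exact: unitarymx1.
  rewrite E; apply: absop_mxop; [exact: unitarymx1|exact: triple_ge|].
  rewrite (triple_map (fun t => t ^+ 2)) spectral_mx1 block21_adj block21_mul.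
  congr block21; complex_ring.
exact: triple_le.
Qed.

End Block.

Theorem theorem1p34 (R : realType) :
  (exists (H : hilbertType R) (Z : H -> H) (j k : nat),
     compact_operator Z /\
     forall p : R, 2 < p ->
       mu (reop Z) (1 + j) + mu (imop Z) (1 + k) < mu (pmeanop Z p) (1 + j + k))
  /\
  (exists (H : hilbertType R) (Z : H -> H),
     compact_operator Z /\
     forall p : R, 2 < p ->
       mu (reop Z) (1 + 2) + mu (imop Z) (1 + 0) < mu (pmeanop Z p) (1 + 2 + 0)).
Proof.
have Zp p : 2 < p ->
    mu (reop (@Zop R)) (1 + 2) + mu (imop (@Zop R)) (1 + 0) <
    mu (pmeanop (@Zop R) p) (1 + 2 + 0).
  move=> p2; apply: le_lt_trans (mu_pmean_Zop p2).
  by rewrite -[leRHS]add0r lerD ?mu_re_Zop ?mu_im_Zop.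
(* The same Z, with (j, k) = (2, 0), witnesses both claims. *)
split; first exists (euclid_hilbert R 3), (@Zop R), 2, 0.
  by split=> //; exact: mxop_compact.
exists (euclid_hilbert R 3), (@Zop R).
by split=> //; exact: mxop_compact.
Qed.
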